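(* Let $n\ge2$ and let $\mu=(\mu_1,\dots,\mu_n)\in\mathbb C^n$ have pairwise distinct components. The unitary rime $R$-matrix $\hat R$ with entries (no summation) $$\hat R^{ij}_{kl}=(1-\beta_{ji})\delta^i_l\delta^j_k+\beta_{ij}\delta^i_k\delta^j_l-\beta_{ij}\delta^i_k\delta^i_l+\beta_{ji}\delta^j_k\delta^j_l,\qquad \beta_{ij}=\frac{1}{\mu_i-\mu_j}\ (i\ne j),\ \beta_{ii}=0,$$ is a quantization of the skew-symmetric classical $r$-matrix $$r=\sum_{i,j:\,i<j}\frac1{\mu_i-\mu_j}\,(e^i_j-e^j_j)\wedge(e^j_i-e^i_i)\in\mathfrak{gl}(n)\wedge\mathfrak{gl}(n).$$ This $r$ corresponds to a Frobenius Lie algebra $(\mathfrak g_0(n),\delta\lambda_n)$, where $\mathfrak g_0(n)\subset\mathfrak{gl}(n)$ is the Lie subalgebra spanned by $Z^i_j:=e^i_j-e^j_j$, $i\ne j$, with the Frobenius structure determined by the coboundary of the 1-cochain $$\lambda_n=-\sum_{i,j:\,i\ne j}\mu_i\,z^i_j ,$$ where $\{z^i_j\}_{i\ne j}$ is the basis of $\mathfrak g_0(n)^*$ dual to $\{Z^i_j\}$ in the sense that $z^i_j(Z^k_l)=\delta^i_l\delta^k_j$.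
   Context: $\mathbb C^n$ has basis $e_1,\dots,e_n$; $e^i_j$ is the matrix unit $e^i_j(e_k)=\delta^i_ke_j$; $x\wedge y=x\otimes y-y\otimes x$; $\hat R(e_k\otimes e_l)=\sum\hat R^{ij}_{kl}e_i\otimes e_j$; $P(e_i\otimes e_j)=e_j\otimes e_i$. A classical $r$-matrix is a solution of $[r_{12},r_{13}]+[r_{12},r_{23}]+[r_{13},r_{23}]=0$; it is skew-symmetric if $r_{12}+r_{21}=0$. ''$\hat R$ is a quantization of $r$'': for a parameter $c\neq 0$, the matrix $\hat R_c$ obtained by replacing $\mu_i$ by $c^{-1}\mu_i$ solves the Yang--Baxter equation $(\hat R\otimes 1)(1\otimes\hat R)(\hat R\otimes 1)=(1\otimes\hat R)(\hat R\otimes 1)(1\otimes\hat R)$ and $P\hat R_c=1\otimes1+c\,r+o(c)$ as $c\to0$. A Lie algebra $\mathfrak f$ is quasi-Frobenius if it admits a non-degenerate 2-cocycle $\omega$, and Frobenius if moreover $\omega$ is a coboundary, $\omega(X,Y)=(\delta\lambda)(X,Y):=\lambda([X,Y])$ for some $\lambda\in\mathfrak f^*$. A skew-symmetric $r$ corresponds to $(\mathfrak f,\omega)$ if, for a basis $\{Z_A\}$ of $\mathfrak f$, $r=\sum_{A,B}r^{AB}Z_A\otimes Z_B$ with $(r^{AB})$ invertible, and $\omega(Z_A,Z_B)=r_{AB}$, where $(r_{AB})$ is the inverse matrix, $\sum_B r^{AB}r_{BC}=\delta^A_C$. *)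

(* Defs.v *)
From HB Require Import structures.
From mathcomp Require Import all_boot all_order all_algebra.
From mathcomp Require Import complex mxtens.
From mathcomp Require Import all_classical all_reals all_analysis.

Set Implicit Arguments.
Unset Strict Implicit.
Unset Printing Implicit Defensive.

Import Order.TTheory GRing.Theory Num.Theory.
Import numFieldNormedType.Exports.

Local Open Scope ring_scope.
Local Open Scope complex_scope.

Local Notation "A *t B" := (tensmx A B)
  (at level 40, left associativity, format "A  *t  B").

(* Operators on F^n, F^n (x) F^n and F^n (x) F^n (x) F^n are matrices of sizes *)
(* n, n * n and n * n * n acting on COLUMN vectors: the entry of X in row i    *)
(* and column k is X^i_k, where X e_k = \sum_i X^i_k e_i.  Pairs of indices    *)
(* are encoded by mxtens_index, so A *t B represents A (x) B, and              *)
(* gl(n) (x) gl(n) is identified with 'M_(n * n).                              *)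

Section TensorOperators.
Context {F : fieldType} {n : nat}.
Implicit Types (A B : 'M[F]_(n * n)%N) (X Y : 'M[F]_n).

Definition commutator {m : nat} (S T : 'M[F]_m) : 'M[F]_m := S *m T - T *m S.

Definition wedge X Y : 'M[F]_(n * n) := X *t Y - Y *t X.

(* E i j k l = A^{ij}_{kl}: rows carry (i, j), columns carry (k, l) *)
Definition tens2_mx (E : 'I_n -> 'I_n -> 'I_n -> 'I_n -> F) : 'M[F]_(n * n) :=
  \matrix_(I, J)
    E (mxtens_unindex I).1 (mxtens_unindex I).2
      (mxtens_unindex J).1 (mxtens_unindex J).2.

Definition flip : 'M[F]_(n * n) :=
  tens2_mx (fun i j k l => ((i == l) && (j == k))%:R).

Definition leg12 A : 'M[F]_(n * n * n) := A *t (1%:M : 'M[F]_n).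

(* the cast identifies (F^n (x) F^n) (x) F^n with F^n (x) (F^n (x) F^n); it    *)
(* preserves the encoding of triples of indices                                *)
Definition leg23 A : 'M[F]_(n * n * n) :=
  castmx (mulnA n n n, mulnA n n n) ((1%:M : 'M[F]_n) *t A).

Definition leg13 A : 'M[F]_(n * n * n) := leg23 flip *m leg12 A *m leg23 flip.

Definition yang_baxter A : Prop :=
  leg12 A *m leg23 A *m leg12 A = leg23 A *m leg12 A *m leg23 A.

Definition classical_yang_baxter A : Prop :=
  commutator (leg12 A) (leg13 A) + commutator (leg12 A) (leg23 A)
    + commutator (leg13 A) (leg23 A) = 0.

(* A_21 = P A P *)
Definition skew_symmetric A : Prop := A + flip *m A *m flip = 0.

Definition unitary A : Prop := A *m A = 1%:M.

(* A^{ij}_{kl} may be nonzero only if {k, l} is contained in {i, j} *)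
Definition rime A : Prop :=
  forall i j k l : 'I_n,
    A (mxtens_index (i, j)) (mxtens_index (k, l)) != 0 ->
    ([set k; l] \subset [set i; j])%SET.

End TensorOperators.

Section LieAlgebras.
Context {F : fieldType} {L : vectType F}.
Implicit Types (br : L -> L -> L) (w : L -> L -> F) (lam : 'Hom(L, F^o)).

Definition lie_bracket br : Prop :=
  [/\ forall x, linear (br x),
      forall y, linear (br^~ y),
      forall x, br x x = 0
    & forall x y z, br (br x y) z + br (br y z) x + br (br z x) y = 0].

Definition two_cocycle br w : Prop :=
  [/\ forall x, scalar (w x),
      forall y, scalar (w^~ y),
      forall x, w x x = 0
    & forall x y z, w (br x y) z + w (br y z) x + w (br z x) y = 0].

Definition nondegenerate w : Prop :=
  forall x, (forall y, w x y = 0) -> x = 0.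

Definition coboundary br lam (x y : L) : F := lam (br x y).

Definition quasi_frobenius br w : Prop :=
  [/\ lie_bracket br, two_cocycle br w & nondegenerate w].

Definition frobenius br w : Prop :=
  quasi_frobenius br w /\ exists lam, forall x y, w x y = coboundary br lam x y.

End LieAlgebras.

Section SubalgebrasOfGl.
Context {F : fieldType} {n : nat}.
Implicit Type g : {vspace 'M[F]_n}.

Definition lie_subalgebra g : Prop :=
  forall X Y, X \in g -> Y \in g -> commutator X Y \in g.

(* vsproj g is the identity on g, so when g is a Lie subalgebra this is the    *)
(* restriction of the commutator                                               *)
Definition sub_bracket g (x y : subvs_of g) : subvs_of g :=
  vsproj g (commutator (vsval x) (vsval y)).

(* rho is the matrix (r^{AB}) and invmx rho the matrix (r_{AB}) *)
Definition corresponds g (w : subvs_of g -> subvs_of g -> F)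
    (r : 'M[F]_(n * n)) : Prop :=
  exists (d : nat) (Z : d.-tuple (subvs_of g)) (rho : 'M[F]_d),
    [/\ basis_of fullv Z,
        rho \in unitmx,
        r = \sum_(A < d) \sum_(B < d)
              rho A B *: (vsval (tnth Z A) *t vsval (tnth Z B))
      & forall A B, w (tnth Z A) (tnth Z B) = invmx rho A B].

End SubalgebrasOfGl.

Arguments sub_bracket {F n} g x y.

Section RimeData.
Context {F : fieldType} {n : nat}.
Implicit Type mu : 'I_n -> F.

(* e^i_j e_k = delta^i_k e_j: the nonzero entry is in row j and column i *)
Definition mxunit (i j : 'I_n) : 'M[F]_n := delta_mx j i.

Definition rime_beta mu (i j : 'I_n) : F :=
  if i == j then 0 else (mu i - mu j)^-1.

Definition rime_R mu : 'M[F]_(n * n) :=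
  tens2_mx (fun i j k l =>
      (1 - rime_beta mu j i) * (i == l)%:R * (j == k)%:R
    + rime_beta mu i j * (i == k)%:R * (j == l)%:R
    - rime_beta mu i j * (i == k)%:R * (i == l)%:R
    + rime_beta mu j i * (j == k)%:R * (j == l)%:R).

Definition rime_r mu : 'M[F]_(n * n) :=
  \sum_(i < n) \sum_(j < n | (i < j)%N)
    (mu i - mu j)^-1 *:
      wedge (mxunit i j - mxunit j j) (mxunit j i - mxunit i i).

Definition g0_gen (i j : 'I_n) : 'M[F]_n := mxunit i j - mxunit j j.

Definition offdiag : seq ('I_n * 'I_n) :=
  [seq p <- enum {: 'I_n * 'I_n} | p.1 != p.2].

Definition g0 : {vspace 'M[F]_n} := <<[seq g0_gen p.1 p.2 | p <- offdiag]>>%VS.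

(* Only the values z i j with i != j matter. *)
Definition g0_dual_basis (z : 'I_n -> 'I_n -> 'Hom(subvs_of g0, F^o)) : Prop :=
  basis_of fullv [seq z p.1 p.2 | p <- offdiag] /\
  forall i j k l, i != j -> k != l ->
    z i j (vsproj g0 (g0_gen k l)) = (i == l)%:R * (k == j)%:R.

Definition g0_cochain mu (z : 'I_n -> 'I_n -> 'Hom(subvs_of g0, F^o)) :
    'Hom(subvs_of g0, F^o) :=
  - \sum_(i < n) \sum_(j < n | i != j) mu i *: z i j.

End RimeData.

Arguments g0 F n : clear implicits.

(* Qhat c abbreviates the rescaled matrix \hat R_c; c ranges over punctured    *)
(* complex neighbourhoods of 0, and o(c) is meant entrywise.                   *)
Definition quantization (R : realType) (n : nat)
    (Rhat : ('I_n -> R[i]) -> 'M[R[i]]_(n * n)) (mu : 'I_n -> R[i])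
    (r : 'M[R[i]]_(n * n)) : Prop :=
  let Qhat (c : R[i]) := Rhat (fun i => c^-1 * mu i) in
  (forall c : R[i], c != 0 -> yang_baxter (Qhat c)) /\
  (forall I J : 'I_(n * n),
     (fun c : R[i]^o => (flip *m Qhat c - 1%:M - c *: r) I J : R[i]^o)
       =o_ (dnbhs (0 : R[i]^o)) (fun c : R[i]^o => c)).

(* Main.v *)
Require Import Defs.
From HB Require Import structures.
From mathcomp Require Import all_boot all_order all_algebra.
From mathcomp Require Import complex mxtens.
From mathcomp Require Import all_classical all_reals all_analysis.
From mathcomp Require Import ring.

(** Write beta_ab = 1 / (mu_a - mu_b), and let an element of
    F^n (x) F^n be given by its coordinates phi(a, b).  The rime property makes
    the action of the two matrices on coordinates free of any summation:

      (R phi)(a, b) = phi(b, a)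
          + beta_ab (phi(a, b) + phi(b, a) - phi(a, a) - phi(b, b)),
      (r phi)(a, b) =
            beta_ab (phi(a, a) + phi(b, b) - phi(a, b) - phi(b, a))

    (sum_rime_R, sum_rime_r).  Hence each operator identity, read off at the
    coordinate (a, b) or (a, b, c), is a polynomial identity in finitely many
    values of phi and of beta, whose indices all lie in {a, b, c}.  It only
    requires that beta is antisymmetric with beta_aa = 0, and, when a, b, c are
    distinct, the relation beta_ab beta_bc = beta_ac (beta_ab + beta_bc);
    coincident indices are separate cases, because the relation fails for
    a = c.  Unitarity, the
    Yang-Baxter equation and the classical Yang-Baxter equation follow.

    Moreover P R = 1 + r exactly (flip_rime_R), and beta is homogeneous of
    degree -1 in mu, so that P R_c = 1 + c r without remainder.

    For the Lie algebra, g0 is the space of matrices with zero row sums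
    (mem_g0P), which is closed under multiplication.  Such a matrix X is
    determined by its off-diagonal entries, and X = sum X_ji Z^i_j; the dual
    basis therefore consists of entries, z^i_j(X) = X_ij, and
    lambda(X) = sum_i mu_i X_ii because the row sums vanish.  So
      lambda([X, Y]) = sum_(i, k) (mu_i - mu_k) X_ik Y_ki,
    which pairs Z^i_j with Z^j_i only, with value mu_j - mu_i: it is
    non-degenerate, and its Gram matrix is inverse to the coefficient matrix of
    r = sum_(i, j) beta_ij Z^i_j (x) Z^j_i (rime_rE). *)

Set Implicit Arguments.
Unset Strict Implicit.
Unset Printing Implicit Defensive.

Import GRing.Theory.

Local Open Scope ring_scope.
Local Open Scope complex_scope.

Local Notation "A *t B" := (tensmx A B)
  (at level 40, left associativity, format "A  *t  B").

(** * Coordinates on tensor powers *)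

Section Coordinates.
Context {F : fieldType} {n : nat}.
Implicit Types (A B : 'M[F]_(n * n)).

(** The columns of M are vectors of F^n (x) F^n: an operator identity becomes a
    statement on coordinates once both sides are applied to an arbitrary M. *)
Definition coord2 p (M : 'M[F]_(n * n, p)) (J : 'I_p) (a b : 'I_n) : F :=
  M (mxtens_index (a, b)) J.

Definition coord3 p (M : 'M[F]_(n * n * n, p)) (J : 'I_p) (a b c : 'I_n) : F :=
  M (mxtens_index (mxtens_index (a, b), c)) J.

Lemma coord2_inj p (M N : 'M[F]_(n * n, p)) :
  (forall J a b, coord2 M J a b = coord2 N J a b) -> M = N.
Proof.
move=> eqMN; apply/matrixP=> I J.
by case: (mxtens_indexP I)=> a b; exact: eqMN.
Qed.

Lemma coord3_inj p (M N : 'M[F]_(n * n * n, p)) :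
  (forall J a b c, coord3 M J a b c = coord3 N J a b c) -> M = N.
Proof.
move=> eqMN; apply/matrixP=> I J; case: (mxtens_indexP I)=> ab c.
by case: (mxtens_indexP ab)=> a b; exact: eqMN.
Qed.

Lemma sum_mxtens_index m p (G : 'I_(m * p) -> F) :
  \sum_I G I = \sum_k \sum_l G (mxtens_index (k, l)).
Proof.
rewrite pair_big /= (reindex (@mxtens_index m p)) /=.
  by apply: eq_bigr=> -[].
by exists (@mxtens_unindex m p)=> i _; rewrite ?mxtens_indexK ?mxtens_unindexK.
Qed.

Lemma sum_delta m (x : 'I_m) (G : 'I_m -> F) :
  \sum_k (x == k)%:R * G k = G x.
Proof.
rewrite (bigD1 x) //= eqxx mul1r big1 ?addr0 // => k.
by rewrite eq_sym => /negPf ->; rewrite mul0r.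
Qed.

Lemma coord2M A p (M : 'M[F]_(n * n, p)) J a b :
  coord2 (A *m M) J a b =
  \sum_k \sum_l A (mxtens_index (a, b)) (mxtens_index (k, l)) * coord2 M J k l.
Proof. by rewrite /coord2 mxE sum_mxtens_index. Qed.

Lemma coord3M12 A p (M : 'M[F]_(n * n * n, p)) J a b c :
  coord3 (leg12 A *m M) J a b c =
  \sum_k \sum_l
     A (mxtens_index (a, b)) (mxtens_index (k, l)) * coord3 M J k l c.
Proof.
rewrite /coord3 mxE sum_mxtens_index sum_mxtens_index.
apply: eq_bigr=> k _; apply: eq_bigr=> l _.
under eq_bigr=> m _ do rewrite tensmxE mxE mulrAC mulrC.
exact: sum_delta.
Qed.

Lemma leg23E A a b c k l m :
  leg23 A (mxtens_index (mxtens_index (a, b), c))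
          (mxtens_index (mxtens_index (k, l), m)) =
  (a == k)%:R * A (mxtens_index (b, c)) (mxtens_index (l, m)).
Proof.
rewrite castmxE.
have assoc x y z : cast_ord (esym (mulnA n n n))
    (mxtens_index (mxtens_index (x, y), z)) =
    mxtens_index (x, mxtens_index (y, z)).
  by apply: val_inj=> /=; rewrite mulnDl mulnA addnA.
by rewrite !assoc tensmxE mxE.
Qed.

Lemma coord3M23 A p (M : 'M[F]_(n * n * n, p)) J a b c :
  coord3 (leg23 A *m M) J a b c =
  \sum_l \sum_m
     A (mxtens_index (b, c)) (mxtens_index (l, m)) * coord3 M J a l m.
Proof.
rewrite /coord3 mxE sum_mxtens_index sum_mxtens_index.
transitivity (\sum_k (a == k)%:R * \sum_l \sum_m
   A (mxtens_index (b, c)) (mxtens_index (l, m)) * coord3 M J k l m).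
  apply: eq_bigr=> k _; rewrite mulr_sumr; apply: eq_bigr=> l _.
  by rewrite mulr_sumr; apply: eq_bigr=> m _; rewrite leg23E mulrA.
exact: sum_delta.
Qed.

Lemma tens2_mxE (E : 'I_n -> 'I_n -> 'I_n -> 'I_n -> F) a b k l :
  tens2_mx E (mxtens_index (a, b)) (mxtens_index (k, l)) = E a b k l.
Proof. by rewrite mxE !mxtens_indexK. Qed.

Lemma sum_flip a b (phi : 'I_n -> 'I_n -> F) :
  \sum_k \sum_l flip (mxtens_index (a, b)) (mxtens_index (k, l)) * phi k l
  = phi b a.
Proof.
rewrite -(sum_delta b (fun k => phi k a)); apply: eq_bigr=> k _.
rewrite -(sum_delta a (fun l => phi k l)) mulr_sumr.
by apply: eq_bigr=> l _; rewrite tens2_mxE -mulnb natrM mulrCA mulrA.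
Qed.

End Coordinates.

(** * The action of the rime matrices on coordinates *)

Section RimeAction.
Context {F : fieldType} {n : nat}.
Variable mu : 'I_n -> F.
Hypothesis mu_inj : injective mu.
Local Notation beta := (rime_beta mu).
Implicit Types a b c : 'I_n.

Lemma betaxx a : beta a a = 0.
Proof. by rewrite /rime_beta eqxx. Qed.

Lemma betaE a b : beta a b = (mu a - mu b)^-1.
Proof.
by rewrite /rime_beta; case: eqP => // ->; rewrite subrr invr0.
Qed.

Lemma betaC a b : beta b a = - beta a b.
Proof. by rewrite !betaE -invrN opprB. Qed.

(** The only property of beta, besides antisymmetry and beta_aa = 0, on which
    both Yang-Baxter equations rest.  It fails for a = c, where it would say
    beta_ab = 0. *)
Lemma beta_arnold a b c : a != b -> b != c -> a != c ->
  beta a b * beta b c = beta a c * (beta a b + beta b c).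
Proof.
move=> ab bc ac; rewrite !betaE; field.
by rewrite !subr_eq0 !(inj_eq mu_inj) ab bc ac.
Qed.

(** In each of the four terms of R the Kronecker deltas bind both summed
    indices to a or b, so nothing remains of the sum. *)
Lemma sum_rime_R a b (phi : 'I_n -> 'I_n -> F) :
  \sum_k \sum_l
    rime_R mu (mxtens_index (a, b)) (mxtens_index (k, l)) * phi k l
  = phi b a + beta a b * (phi a b + phi b a - phi a a - phi b b).
Proof.
pose S x y := \sum_k \sum_l (x == k)%:R * ((y == l)%:R * phi k l).
have SE x y : S x y = phi x y.
  rewrite /S -(sum_delta x (fun k => phi k y)); apply: eq_bigr=> k _.
  by rewrite -mulr_sumr sum_delta.
transitivity ((1 - beta b a) * S b a + beta a b * S a b - beta a b * S a a
  + beta b a * S b b).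
  rewrite !mulr_sumr -sumrN -!big_split; apply: eq_bigr=> k _ /=.
  rewrite !mulr_sumr -sumrN -!big_split; apply: eq_bigr=> l _ /=.
  rewrite tens2_mxE; ring.
rewrite !SE (betaC a b); ring.
Qed.

Lemma g0_genE i j a k :
  g0_gen i j a k = (a == j)%:R * ((k == i)%:R - (k == j)%:R) :> F.
Proof. by rewrite !mxE -!mulnb !natrM mulrBr. Qed.

(** The summand of r is invariant under exchanging i and j, since beta and the
    wedge both change sign; so the wedges over i < j unfold into the plain
    tensors over all ordered pairs, the diagonal being killed by beta_ii = 0. *)
Lemma rime_rE : rime_r mu =
  \sum_i \sum_j beta i j *: (g0_gen i j *t g0_gen j i).
Proof.
pose T i j := beta i j *: (g0_gen i j *t g0_gen j i).
rewrite -/T; transitivity (\sum_(i < n) (\sum_(j < n | (i < j)%N) T i j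
                       + \sum_(j < n | (j < i)%N) T i j)).
  rewrite big_split /=
    [X in _ = _ + X](exchange_big_dep predT) //= -big_split /=.
  apply: eq_bigr=> i _; rewrite -big_split; apply: eq_bigr=> j _ /=.
  by rewrite /T (betaC i j) scaleNr -scalerBr betaE.
apply: eq_bigr=> i _; rewrite [RHS](bigD1 i) //= {2}/T betaxx scale0r add0r.
rewrite [RHS](bigID (fun j : 'I_n => (i < j)%N)) /=.
by congr (_ + _); apply: eq_bigl=> j; rewrite -val_eqE /= neq_ltn;
   case: ltngtP.
Qed.

Lemma rime_r_entry a b k l :
  rime_r mu (mxtens_index (a, b)) (mxtens_index (k, l)) =
  rime_R mu (mxtens_index (b, a)) (mxtens_index (k, l))
  - (a == k)%:R * (b == l)%:R.
Proof.
transitivity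
    (beta b a * ((k == b)%:R - (k == a)%:R) * ((l == a)%:R - (l == b)%:R)).
  rewrite rime_rE summxE.
  rewrite -(sum_delta b (fun i => beta i a * _ * _)); apply: eq_bigr=> i _.
  rewrite summxE -(sum_delta a (fun j => beta i j * _ * _)) mulr_sumr.
  apply: eq_bigr=> j _; rewrite mxE tensmxE !g0_genE; ring.
rewrite tens2_mxE (betaC b a).
rewrite (eq_sym k b) (eq_sym k a) (eq_sym l a) (eq_sym l b); ring.
Qed.

Lemma flip_rime_R : flip *m rime_R mu = 1%:M + rime_r mu.
Proof.
apply: coord2_inj=> J a b; rewrite coord2M sum_flip.
case: (mxtens_indexP J)=> k l.
rewrite /coord2 [RHS]mxE [X in _ = X + _]mxE.
rewrite (can_eq (@mxtens_indexK n n)) -pair_eqE -mulnb natrM.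
by rewrite rime_r_entry addrC subrK.
Qed.

Lemma sum_rime_r a b (phi : 'I_n -> 'I_n -> F) :
  \sum_k \sum_l
    rime_r mu (mxtens_index (a, b)) (mxtens_index (k, l)) * phi k l
  = beta a b * (phi a a + phi b b - phi a b - phi b a).
Proof.
transitivity (\sum_k \sum_l
    rime_R mu (mxtens_index (b, a)) (mxtens_index (k, l)) * phi k l
  - \sum_k (a == k)%:R * \sum_l (b == l)%:R * phi k l).
  rewrite -sumrB; apply: eq_bigr=> k _; rewrite mulr_sumr -sumrB.
  by apply: eq_bigr=> l _; rewrite rime_r_entry mulrBl -mulrA.
rewrite sum_rime_R !sum_delta (betaC a b); ring.
Qed.

End RimeAction.

(** * Unitarity and the Yang-Baxter equations *)

Section YangBaxter.
Context {F : fieldType} {n : nat}.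
Variable mu : 'I_n -> F.
Hypothesis mu_inj : injective mu.
Local Notation beta := (rime_beta mu).

Lemma triple_cases (P : 'I_n -> 'I_n -> 'I_n -> Prop) :
  (forall a b, P a a b) -> (forall a b, P a b a) -> (forall a b, P a b b) ->
  (forall a b c, a != b -> b != c -> a != c -> P a b c) ->
  forall a b c, P a b c.
Proof.
move=> h1 h2 h3 h4 a b c.
have [->//|ab] := eqVneq a b; have [->//|bc] := eqVneq b c.
have [->//|ac] := eqVneq a c; exact: h4.
Qed.

(** Both sides, applied to phi and evaluated at (a, b, c), are cubic in beta
    and linear in the 27 values of phi on {a, b, c}^3. *)
Lemma yang_baxter_rime : yang_baxter (rime_R mu).
Proof.
rewrite /yang_baxter -[LHS]mulmx1 -[RHS]mulmx1 -!mulmxA.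
move: (1%:M) => M; apply: coord3_inj => J a b c.
rewrite !(coord3M12, coord3M23, sum_rime_R).
move: (coord3 M J) => phi; move: a b c.
apply: triple_cases => [a b|a b|a b|a b c ab bc ac].
- rewrite !betaxx (betaC mu a b); ring.
- rewrite !betaxx (betaC mu a b); ring.
- rewrite !betaxx (betaC mu a b); ring.
rewrite !betaxx (betaC mu a b) ?(betaC mu b c) ?(betaC mu a c).
ring: (beta_arnold mu_inj ab bc ac).
Qed.

Lemma coord3D p (M N : 'M[F]_(n * n * n, p)) J a b c :
  coord3 (M + N) J a b c = coord3 M J a b c + coord3 N J a b c.
Proof. by rewrite /coord3 mxE. Qed.

Lemma coord3N p (M : 'M[F]_(n * n * n, p)) J a b c :
  coord3 (- M) J a b c = - coord3 M J a b c.
Proof. by rewrite /coord3 mxE. Qed.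

Lemma classical_yang_baxter_rime : classical_yang_baxter (rime_r mu).
Proof.
rewrite /classical_yang_baxter /commutator /leg13 -[LHS]mulmx1.
move: (1%:M) => M; apply: coord3_inj => J a b c.
rewrite !(mulmxDl, mulNmx) -!mulmxA !(coord3D, coord3N).
rewrite !(coord3M12, coord3M23, sum_flip, sum_rime_r) [RHS]mxE.
move: (coord3 M J) => phi; move: a b c.
apply: triple_cases => [a b|a b|a b|a b c ab bc ac].
- rewrite !betaxx (betaC mu a b); ring.
- rewrite !betaxx (betaC mu a b); ring.
- rewrite !betaxx (betaC mu a b); ring.
rewrite ?(betaC mu a b) ?(betaC mu b c) ?(betaC mu a c).
ring: (beta_arnold mu_inj ab bc ac).
Qed.

Lemma unitary_rime : unitary (rime_R mu).
Proof.
rewrite /unitary -[LHS]mulmx1 -!mulmxA; apply: coord2_inj=> J a b.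
move: (1%:M) => M.
rewrite !(coord2M, sum_rime_R) !betaxx (betaC mu a b); ring.
Qed.

Lemma skew_symmetric_rime_r : skew_symmetric (rime_r mu).
Proof.
rewrite /skew_symmetric -[LHS]mulmx1.
move: (1%:M) => M; apply: coord2_inj => J a b.
rewrite mulmxDl -!mulmxA.
rewrite [LHS]mxE -!/(coord2 _ _ _ _) [RHS]mxE.
rewrite !(coord2M, sum_flip, sum_rime_r) (betaC mu a b); ring.
Qed.

Lemma rime_rime_R : rime (rime_R mu).
Proof.
move=> i j k l; rewrite tens2_mxE => Rn0.
rewrite finset.subUset !finset.sub1set !in_set2.
move: Rn0; case: (eqVneq i l) => [il|_]; case: (eqVneq j k) => [jk|_];
  case: (eqVneq i k) => [ik|_]; case: (eqVneq j l) => [jl|_];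
  rewrite ?(mulr0n, mulr0, mul0r, addr0, subr0, eqxx) //.
all: by subst; rewrite ?eqxx ?orbT.
Qed.

End YangBaxter.

(** * The quantization property *)

Lemma quantization_rime (R : realType) (n : nat) (mu : 'I_n -> R[i]) :
  injective mu -> quantization rime_R mu (rime_r mu).
Proof.
move=> mu_inj; split=> [c c0|I J].
  apply: yang_baxter_rime => a b /(mulfI _); rewrite invr_eq0 => /(_ c0).
  exact: mu_inj.
(* the remainder vanishes, even at c = 0, where c^-1 = 0 turns beta into 0 *)
rewrite (_ : (fun c => _) = 0); last first.
  apply/funext => c; rewrite flip_rime_R (_ : rime_r _ = c *: rime_r mu).
    by rewrite [1%:M + _]addrC addrK subrr mxE.
  rewrite !rime_rE scaler_sumr; apply: eq_bigr=> i _.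
  rewrite scaler_sumr; apply: eq_bigr=> j _.
  by rewrite scalerA !betaE -mulrBr invfM invrK.
by apply/eqoP; exact: littleo0_subproof.
Qed.

(** * Bases and cocycles in a general setting *)

(** Independence by induction on s: b p lies outside the span of the other
    vectors, because f p annihilates them and not b p. *)
Lemma dual_family_basis (K : fieldType) (V : vectType K) (T : eqType)
    (s : seq T) (b : T -> V) (f : T -> {linear V -> K^o}) :
  uniq s -> {in s &, forall p q, f p (b q) = (p == q)%:R} ->
  (forall v, v = \sum_(p <- s) f p v *: b p) ->
  basis_of fullv [seq b p | p <- s].
Proof.
move=> s_uniq dual expand; rewrite /basis_of; apply/andP; split.
  rewrite eqEsubv subvf; apply/subvP=> v _; rewrite (expand v) big_seq.
  by apply: memv_suml=> p ps; rewrite memvZ // memv_span // map_f.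
elim: s s_uniq dual {expand} => [|p s IHs] /=; first by rewrite nil_free.
move=> /andP[ps s_uniq] dual; rewrite free_cons IHs ?andbT //; last first.
  by move=> q r qs rs; rewrite dual // inE ?qs ?rs orbT.
apply/negP=> bp_span.
have ker_s : (<<[seq b q | q <- s]>> <= lker (linfun (f p)))%VS.
  apply/span_subvP=> _ /mapP[q qs ->]; rewrite memv_ker lfunE /=.
  rewrite dual ?inE ?eqxx ?qs ?orbT //.
  by case: (p =P q) ps => [->|_ _]; rewrite ?qs ?eqxx.
have := subvP ker_s _ bp_span; rewrite memv_ker lfunE /= dual ?inE ?eqxx //.
by rewrite oner_eq0.
Qed.

(** The cocycle identity of a coboundary is the image under lam of the Jacobi
    identity. *)
Lemma coboundary_two_cocycle (K : fieldType) (L : vectType K)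
    (br : L -> L -> L) (lam : 'Hom(L, K^o)) :
  lie_bracket br -> two_cocycle br (coboundary br lam).
Proof.
case=> linr linl alt jacobi; rewrite /coboundary; split.
- by move=> x a y z; rewrite linr linearP.
- by move=> y a x z; rewrite linl linearP.
- by move=> x; rewrite alt linear0.
- by move=> x y z; rewrite -[RHS](linear0 lam) -(jacobi x y z) !linearD.
Qed.

(** * The Lie algebra of matrices with zero row sums *)

Section LieAlgebraG0.
Context {F : fieldType} {n : nat}.
Implicit Types (X Y : 'M[F]_n) (i j k l : 'I_n).

Lemma mem_offdiag i j : ((i, j) \in offdiag) = (i != j).
Proof. by rewrite mem_filter mem_enum andbT. Qed.

Lemma big_offdiag (V : nmodType) (G : 'I_n * 'I_n -> V) :
  \sum_(p <- offdiag) G p = \sum_i \sum_(j | i != j) G (i, j).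
Proof.
rewrite /offdiag big_filter big_enum_cond /= pair_big_dep /=.
by apply: eq_big => [[]|[]].
Qed.

Lemma big_offdiag1 (V : nmodType) (G : 'I_n * 'I_n -> V) q0 :
  q0.1 != q0.2 -> \sum_(q <- offdiag) (if q == q0 then G q else 0) = G q0.
Proof.
move=> q0_off; rewrite /offdiag big_filter big_enum_cond /=.
rewrite (bigD1 q0) //= eqxx big1 ?addr0 // => q /andP[_ /negPf ->//].
Qed.

(** The generator Z^i_j carries 1 at (j, i) and -1 at (j, j): off the diagonal
    the expansion is tautological, and on it the row sum decides. *)
Lemma g0_gen_expansion X : (forall j, \sum_i X j i = 0) ->
  X = \sum_i \sum_(j | i != j) X j i *: g0_gen i j.
Proof.
move=> X0; apply/matrixP=> a k; rewrite summxE.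
transitivity (\sum_i (X a i * (k == i)%:R - X a i * (k == a)%:R)).
  rewrite sumrB -mulr_suml X0 mul0r subr0.
  by under eq_bigr => i _ do rewrite mulrC; rewrite sum_delta.
apply: eq_bigr=> i _; rewrite summxE -mulrBr.
rewrite -(sum_delta a (fun j => X j i * ((k == i)%:R - (k == j)%:R))).
rewrite (bigD1 i) //= subrr !mulr0 add0r.
apply: eq_big => [j|j _]; first by rewrite eq_sym.
by rewrite [RHS]mxE g0_genE mulrCA.
Qed.

Lemma mem_g0_gen i j : i != j -> g0_gen i j \in g0 F n.
Proof.
move=> ij; apply/memv_span/mapP; exists (i, j) => //.
by rewrite mem_offdiag.
Qed.

(** This is what makes g0 closed under products, not only under commutators: it
    is the annihilator of the all-ones column. *)
Lemma mem_g0P X : reflect (forall j, \sum_i X j i = 0) (X \in g0 F n).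
Proof.
apply: (iffP idP) => [Xg j|X0]; last first.
  rewrite (g0_gen_expansion X0); apply: memv_suml=> i _.
  by apply: memv_suml=> j ij; rewrite memvZ // mem_g0_gen.
have: (g0 F n <= lker (linfun (mulmxr (const_mx 1 : 'cV[F]_n))))%VS.
  apply/span_subvP => _ /mapP[[k l] _ ->]; rewrite memv_ker lfunE /=.
  apply/eqP/matrixP => a b; rewrite !mxE.
  under eq_bigr => i _ do rewrite g0_genE mxE mulr1.
  rewrite -mulr_sumr sumrB.
  under eq_bigr => i _ do rewrite eq_sym -[_%:R]mulr1.
  rewrite sum_delta.
  under eq_bigr => i _ do rewrite eq_sym -[_%:R]mulr1.
  by rewrite sum_delta subrr mulr0.
move/subvP/(_ X Xg); rewrite memv_ker lfunE /= => /eqP/matrixP/(_ j 0).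
rewrite !mxE => Xj; rewrite -[RHS]Xj.
by apply: eq_bigr => i _; rewrite mxE mulr1.
Qed.

Lemma lie_subalgebra_g0 : lie_subalgebra (g0 F n).
Proof.
move=> X Y /mem_g0P X0 /mem_g0P Y0; apply/mem_g0P=> j.
(* A (B 1) = 0 as soon as B 1 = 0 *)
have row0 (A B : 'M[F]_n) : (forall j, \sum_i B j i = 0) ->
    \sum_i (A *m B) j i = 0.
  move=> B0; under eq_bigr => i _ do rewrite mxE.
  by rewrite exchange_big big1 // => k _; rewrite -mulr_sumr B0 mulr0.
rewrite /commutator; under eq_bigr => i _ do rewrite mxE [X in _ + X]mxE.
by rewrite sumrB !row0 // subrr.
Qed.

Local Notation g := (subvs_of (g0 F n)).
Local Notation br := (sub_bracket (g0 F n)).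
Implicit Types x y : g.

Lemma g0_rowsum x j : \sum_i vsval x j i = 0.
Proof. by move: j; apply/mem_g0P/subvsP. Qed.

Lemma vsval_sub_bracket x y : vsval (br x y) = commutator (vsval x) (vsval y).
Proof. by rewrite vsprojK // lie_subalgebra_g0 ?subvsP. Qed.

Lemma lie_bracket_g0 : lie_bracket br.
Proof.
split=> [x a y z|y a x z|x|x y z]; apply: val_inj; rewrite /=.
- rewrite ?linearP /= !vsval_sub_bracket linearP /= /commutator.
  by rewrite mulmxDr mulmxDl -scalemxAl -scalemxAr scalerBr opprD addrACA.
- rewrite ?linearP /= !vsval_sub_bracket linearP /= /commutator.
  by rewrite mulmxDr mulmxDl -scalemxAl -scalemxAr scalerBr opprD addrACA.
- by rewrite vsval_sub_bracket /commutator subrr.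
rewrite !vsval_sub_bracket /commutator.
rewrite !mulmxBl !mulmxBr !mulmxA.
have eD (A B : 'M[F]_n) i j : (A + B) i j = A i j + B i j by rewrite mxE.
have eN (A : 'M[F]_n) i j : (- A) i j = - A i j by rewrite mxE.
by apply/matrixP=> i j; rewrite !(eD, eN) [RHS]mxE; ring.
Qed.

Definition g0_entry i j x : F^o := vsval x i j.

Fact g0_entry_is_linear i j : linear (g0_entry i j).
Proof. by move=> a x y; rewrite /g0_entry linearP /= mxE mxE. Qed.

HB.instance Definition _ i j :=
  GRing.isLinear.Build F g F^o *:%R (g0_entry i j) (g0_entry_is_linear i j).

Definition g0_coord i j : 'Hom(g, F^o) := linfun (g0_entry i j).

Definition g0_basis (p : 'I_n * 'I_n) : g := vsproj (g0 F n) (g0_gen p.1 p.2).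

Lemma vsval_g0_basis i j : i != j -> vsval (g0_basis (i, j)) = g0_gen i j.
Proof. by move=> ij; rewrite vsprojK // mem_g0_gen. Qed.

Lemma g0_entry_basis i j k l : i != j -> k != l ->
  g0_entry i j (g0_basis (k, l)) = (i == l)%:R * (k == j)%:R.
Proof.
move=> ij kl; rewrite /g0_entry vsval_g0_basis // g0_genE (eq_sym j k).
by case: eqP => [<-|]; rewrite ?mul0r // (eq_sym j i) (negPf ij) subr0.
Qed.

Lemma g0_expansion x :
  x = \sum_i \sum_(j | i != j) vsval x j i *: g0_basis (i, j).
Proof.
apply: val_inj; rewrite /= linear_sum [LHS](g0_gen_expansion (g0_rowsum x)).
apply: eq_bigr=> i _; rewrite linear_sum; apply: eq_bigr=> j ij.
by rewrite linearZ /= vsval_g0_basis.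
Qed.

Lemma basis_g0 : basis_of fullv [seq g0_basis p | p <- offdiag].
Proof.
apply: (@dual_family_basis _ _ _ _ _ (fun p => g0_entry p.2 p.1)).
- by rewrite filter_uniq ?enum_uniq.
- move=> [i j] [k l]; rewrite !mem_offdiag => ij kl /=.
  have ji : j != i by rewrite eq_sym.
  by rewrite g0_entry_basis // -natrM mulnb -pair_eqE /= andbC (eq_sym k).
- by move=> x; rewrite big_offdiag -g0_expansion.
Qed.

Definition lfun_eval (V W : vectType F) (v : V) (f : 'Hom(V, W)) : W := f v.

Fact lfun_eval_is_linear (V W : vectType F) v : linear (@lfun_eval V W v).
Proof. by move=> a f h; rewrite /lfun_eval add_lfunE scale_lfunE. Qed.

HB.instance Definition _ (V W : vectType F) v :=
  GRing.isLinear.Build F 'Hom(V, W) W *:%R (@lfun_eval V W v)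
    (@lfun_eval_is_linear V W v).

Lemma g0_coordE i j x : g0_coord i j x = vsval x i j.
Proof. by rewrite lfunE. Qed.

(** The indices are transposed: z^i_j is dual to Z^j_i, whose only
    off-diagonal entry is at (i, j). *)
Lemma g0_dual_basis_coord : g0_dual_basis g0_coord.
Proof.
split; last by move=> i j k l ij kl; rewrite g0_coordE; exact: g0_entry_basis.
apply: (@dual_family_basis _ _ _ _ _
  (fun p => lfun_eval (g0_basis (p.2, p.1)) : {linear _ -> F^o})).
- by rewrite filter_uniq ?enum_uniq.
- move=> [i j] [k l]; rewrite !mem_offdiag => ij kl /=.
  have ji : j != i by rewrite eq_sym.
  rewrite /lfun_eval g0_coordE -/(g0_entry _ _ _) g0_entry_basis //.
  by rewrite -natrM mulnb -pair_eqE /= (eq_sym k).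
- move=> f; apply/lfunP => x; rewrite {1}(g0_expansion x) big_offdiag.
  rewrite linear_sum sum_lfunE.
  under eq_bigr => i _ do rewrite linear_sum.
  under [RHS]eq_bigr => i _ do rewrite sum_lfunE.
  rewrite (exchange_big_dep predT) //=; apply: eq_bigr => i _.
  apply: eq_big => [j|j _]; first by rewrite eq_sym.
  by rewrite linearZ scale_lfunE g0_coordE; exact: mulrC.
Qed.

(** * The Frobenius form and its inverse *)

Section FrobeniusForm.
Variable mu : 'I_n -> F.
Hypothesis mu_inj : injective mu.

Local Notation lam := (g0_cochain mu g0_coord).
Local Notation w := (coboundary br lam).

(** Vanishing of the row sums trades - sum_(j != i) X_ij for X_ii. *)
Lemma g0_cochainE x : lam x = \sum_i mu i * vsval x i i.
Proof.
rewrite opp_lfunE sum_lfunE -sumrN; apply: eq_bigr => i _.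
rewrite sum_lfunE -sumrN; have := g0_rowsum x i.
rewrite (bigD1 i) //= => /eqP; rewrite addr_eq0 => /eqP ->.
rewrite -sumrN mulr_sumr; apply: eq_big => [j|j _]; first by rewrite eq_sym.
by rewrite scale_lfunE g0_coordE mulrN.
Qed.

(** The trace form tr (D [X, Y]) of the diagonal matrix D of the mu_i. *)
Lemma g0_formE x y :
  w x y = \sum_i \sum_k (mu i - mu k) * vsval x i k * vsval y k i.
Proof.
rewrite /coboundary g0_cochainE.
transitivity (\sum_i \sum_k mu i * (vsval x i k * vsval y k i)
            - \sum_i \sum_k mu i * (vsval y i k * vsval x k i)).
  rewrite -sumrB; apply: eq_bigr => i _; rewrite -!mulr_sumr -mulrBr.
  by rewrite vsval_sub_bracket /commutator mxE mxE [X in _ + X]mxE mxE.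
rewrite [X in _ - X]exchange_big /= -sumrB; apply: eq_bigr=> i _.
by rewrite -sumrB; apply: eq_bigr=> k _; ring.
Qed.

(** The diagonal entry of Z^i_j does not contribute, as the form vanishes on
    diagonal entries; hence pairing with Z^i_j isolates one entry of x. *)
Lemma g0_form_basis x i j : i != j ->
  w x (g0_basis (i, j)) = (mu i - mu j) * vsval x i j.
Proof.
move=> ij; rewrite g0_formE vsval_g0_basis //.
rewrite -(sum_delta i (fun a => (mu a - mu j) * vsval x a j)).
apply: eq_bigr => a _.
rewrite -(sum_delta j (fun k => _ * ((mu a - mu k) * _ a k))).
apply: eq_bigr => k _; rewrite g0_genE (eq_sym k j) (eq_sym i a).
have [<-|_] := eqVneq j k; last by rewrite !mul0r mulr0.
by have [->|] := eqVneq a j; [rewrite subrr | move=> _; rewrite subr0]; ring.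
Qed.

Lemma frobenius_g0 : frobenius br w.
Proof.
split; last by exists lam.
split; [exact: lie_bracket_g0| |].
  exact: coboundary_two_cocycle lie_bracket_g0.
move=> x x0; rewrite (g0_expansion x) big1 // => i _; rewrite big1 // => j ij.
have ji : j != i by rewrite eq_sym.
have /eqP := x0 (g0_basis (j, i)); rewrite g0_form_basis //.
rewrite mulf_eq0 subr_eq0 (inj_eq mu_inj) (negPf ji) /= => /eqP xji.
by rewrite xji scale0r.
Qed.

(** Both rho and the Gram matrix W of the form are supported on the pairs
    (Z^i_j, Z^j_i), with entries beta_ij and mu_j - mu_i; the product rho W
    composes the transposition of indices with itself. *)
Lemma corresponds_g0 : corresponds w (rime_r mu).
Proof.
(* o numbers the pairs i != j, and hence the basis, by 'I_d *)
pose o A := tnth (in_tuple (@offdiag n)) A.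
have o_off A : (o A).1 != (o A).2.
  by have := mem_tnth A (in_tuple (@offdiag n)); rewrite mem_filter => /andP[].
pose swap (p : 'I_n * 'I_n) := (p.2, p.1).
have swap_off A : (swap (o A)).1 != (swap (o A)).2 by rewrite eq_sym o_off.
pose rho := \matrix_(A, B)
  (if o B == swap (o A) then rime_beta mu (o A).1 (o A).2 else 0).
pose W := \matrix_(A, B) w (g0_basis (o A)) (g0_basis (o B)).
have rhoW : rho *m W = 1%:M.
  apply/matrixP=> A C; rewrite !mxE.
  transitivity (\sum_(q <- offdiag) if q == swap (o A) then
     rime_beta mu (o A).1 (o A).2 * w (g0_basis q) (g0_basis (o C)) else 0).
    rewrite [RHS]big_tnth; apply: eq_bigr=> B _; rewrite !mxE -/(o B).
    by case: ifP=> // _; rewrite mul0r.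
  rewrite big_offdiag1 //.
  have <- : (o A == o C) = (A == C).
    apply/eqP/eqP => [|->//]; apply/tuple_uniqP.
    by rewrite filter_uniq ?enum_uniq.
  move: (o_off A) (o_off C); case: (o A) (o C) => [a b] [c d] /= ab cd.
  have ba : b != a by rewrite eq_sym.
  rewrite g0_form_basis // /swap /= -/(g0_entry _ _ _) g0_entry_basis //.
  rewrite -pair_eqE /=.
  have [->|] := eqVneq a c; last by rewrite !(mul0r, mulr0).
  have [->|] := eqVneq b d; last by rewrite !(mul0r, mulr0).
  by rewrite /= !mulr1 betaE mulVf // subr_eq0 (inj_eq mu_inj).
have rho_unit : rho \in unitmx by case: (mulmx1_unit rhoW).
exists _, (map_tuple g0_basis (in_tuple (@offdiag n))), rho; split=> //.
- exact: basis_g0.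
- rewrite rime_rE.
  transitivity (\sum_(p <- offdiag)
     rime_beta mu p.1 p.2 *: (g0_gen p.1 p.2 *t g0_gen p.2 p.1)).
    rewrite big_offdiag; apply: eq_bigr => i _; rewrite (bigD1 i) //=.
    rewrite betaxx scale0r add0r; by apply: eq_bigl => j; rewrite eq_sym.
  rewrite [LHS]big_tnth; apply: eq_bigr=> A _; rewrite -/(o A).
  rewrite -(@big_offdiag1 _ (fun q => rime_beta mu (o A).1 (o A).2 *:
             (g0_gen (o A).1 (o A).2 *t g0_gen q.1 q.2)) (swap (o A))) //.
  rewrite [LHS]big_tnth; apply: eq_bigr=> B _; rewrite -/(o B) !mxE.
  rewrite !tnth_map -/(o A) -/(o B).
  move: (o_off A) (o_off B); case: (o A) (o B) => [a b] [c d] /= ab cd.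
  by rewrite !vsval_g0_basis //; case: ifP => // _; rewrite scale0r.
- move=> A B; rewrite !tnth_map -/(o A) -/(o B).
  suff -> : invmx rho = W by rewrite mxE.
  by rewrite -[LHS]mulmx1 -rhoW mulKmx.
Qed.

End FrobeniusForm.
End LieAlgebraG0.

(** * The rime R-matrix and its classical limit *)

Unset Implicit Arguments.

Theorem proposition6 (R : realType) (n : nat) (n_ge2 : (2 <= n)%N)
    (mu : 'I_n -> R[i]) (mu_inj : injective mu) :
  [/\ unitary (rime_R mu) /\ rime (rime_R mu),
      skew_symmetric (rime_r mu) /\ classical_yang_baxter (rime_r mu),
      quantization rime_R mu (rime_r mu),
      lie_subalgebra (g0 R[i] n)
    & exists z : 'I_n -> 'I_n -> 'Hom(subvs_of (g0 R[i] n), R[i]^o),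
        [/\ g0_dual_basis z,
            frobenius (sub_bracket (g0 R[i] n))
              (coboundary (sub_bracket (g0 R[i] n)) (g0_cochain mu z))
          & corresponds
              (coboundary (sub_bracket (g0 R[i] n)) (g0_cochain mu z))
              (rime_r mu)]].
Proof.
split.
- by split; [exact: unitary_rime | exact: rime_rime_R].
- by split; [exact: skew_symmetric_rime_r | exact: classical_yang_baxter_rime].
- exact: quantization_rime.
- exact: lie_subalgebra_g0.
exists g0_coord; split; first exact: g0_dual_basis_coord.
- exact: frobenius_g0.
- exact: corresponds_g0.
Qed.
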